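(* Let $(X,T)$ be a t.d.s. and let $(Y,\sigma)$ be the system constructed from $(X,T)$ and the sequence $(\epsilon_k)_{k\ge0}$ as described in the context. Then \[ h_{\rm top}(Y,\sigma)\ \ge\ h_{\rm top}(X,T)\cdot\prod_{k=0}^{\infty}(1-2\epsilon_k). \]
   Context: A t.d.s. $(X,T)$ is a compact metric space $X$ with metric $d_X$ together with a homeomorphism $T:X\to X$. Topological entropy: $h_{\rm top}(X,T)=\lim_{\epsilon\to0}\limsup_{n\to\infty}\frac1n\log s_n(X,T,\epsilon)=\lim_{\epsilon\to0}\liminf_{n\to\infty}\frac1n\log s_n(X,T,\epsilon)\in[0,\infty]$, where $s_n(X,T,\epsilon)$ is the maximal cardinality of a set $E\subset X$ such that for any distinct $x,y\in E$ there is $0\le n'<n$ with $d_X(T^{n'}x,T^{n'}y)>\epsilon$. Convention: $\infty\cdot 0=0$. Construction of $(Y,\sigma)$ from a t.d.s. $(X,T)$. Let $X_*=X\cup\{*\}$ with $*\notin X$ an added isolated point: $d_{X_*}$ extends $d_X$ with $d_{X_*}(x,* )=\mathrm{diam}(X)+1$ for $x\in X$; let $T_*:X_*\to X_*$ be $T$ on $X$ and $T_*( * )=*$. Let $X_*^{\mathbb Z}$ have the product topology (and a compatible metric) and let $\sigma((x_i)_i)=(x_{i+1})_i$. Fix a decreasing sequence $(\epsilon_k)_{k\ge0}$ with $0<\epsilon_k<1/2$. Fix integers $n_0<n_1<n_2<\cdots$ and, for each $k\ge 0$, a disjoint union $\{0,1,\dots,n_k-1\}=A_k\cup B_k$ with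 $0,n_k-1\in B_k$ such that: (i) $2\le\#A_k<n_k\epsilon_k$; (ii) for every integer $0\le i<n_k$ there is $a\in A_k$ with $a+i\in A_k\cup(n_k+A_k)$; (iii) for every integer $0<i\le \frac{n_k}{2}+1$, $\#((A_k+i)\cap B_k)\ge\sqrt{n_k/2}-1$ (such choices exist). Put $p_{-1}=1$, $p_k=n_kp_{k-1}$, $b_k=\#B_k$, and let $\tau_k:B_k\to\{0,1,\dots,b_k-1\}$ be the strictly increasing bijection. Define $f_k:B_k\to(-(b_k-2),0]\cap\mathbb Z$ by $f_k(0)=0$, $f_k(n_k-1)=-(b_k-3)$, and $f_k(i)=\tau_k(i)-(b_k-2)$ otherwise. Put $b'_{-1}=1$ and $b'_k=b'_{k-1}\cdot\#f_k(B_k)=b'_{k-1}(b_k-2)$ for $k\ge0$. Define $g_k:B_k\times X_*\to X_*$ by $g_k(i,x)=T_*^{\,b'_{k-1}f_k(i)}x$. Let $Q_k=\{x\in X_*^{\mathbb Z}: x_{ip_{k-1}}=g_k(i,x_0)\ \forall i\in B_k\}$ and $P_k=\{x\in X_*^{\mathbb Z}: x_{ip_{k-1}}=*\ \forall i\in A_k\}$. Let $Y_{-1}=X_*^{\mathbb Z}$, $Y_k=Y_{k-1}\cap\bigcap_{n\in\mathbb Z}\sigma^{np_k}(P_k\cap Q_k)$ for $k\ge0$, and $Y=\bigcap_{k=0}^\infty\bigcup_{r=0}^{p_k-1}\sigma^{-r}Y_k$. $Y$ is closed and $\sigma$-invariant, and $(Y,\sigma)$ denotes the corresponding subsystem of $(X_*^{\mathbb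 Z},\sigma)$. *)

(* Defs.v *)
From HB Require Import structures.
From mathcomp Require Import all_boot all_order all_algebra finmap.
From mathcomp Require Import all_classical all_reals all_analysis.

Set Implicit Arguments.
Unset Strict Implicit.
Unset Printing Implicit Defensive.

Import Order.TTheory GRing.Theory Num.Theory.
Import numFieldNormedType.Exports.

Local Open Scope classical_set_scope.
Local Open Scope ring_scope.

Section Entropy.
Context {R : realType} {M : Type}.
Variables (d : M -> M -> R) (f : M -> M).

Definition sep_set (n : nat) (eps : R) (E : set M) : Prop :=
  forall x y, E x -> E y -> x <> y ->
    exists2 j : nat, (j < n)%N & eps < d (iter j f x) (iter j f y).

(* s_n of the restriction of f to S; when S is compact for d the supremum is a
   maximum. *)
Definition sep_num (S : set M) (n : nat) (eps : R) : \bar R :=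
  ereal_sup [set (m%:R)%:E | m in
    [set m : nat | exists E : set M,
       [/\ E `<=` S, (E #= `I_m)%card & sep_set n eps E]]].

(* Topological entropy of the subsystem (S, f), for an f-invariant S. *)
Definition htop (S : set M) : \bar R :=
  lim ((fun eps : R =>
    limn_esup (fun n : nat => ((n%:R^-1)%:E * lne (sep_num S n eps))%E))
    @ 0^'+).

End Entropy.

Definition compatible_metric {R : realType} {M : topologicalType}
    (rho : M -> M -> R) : Prop :=
  [/\ forall x, rho x x = 0,
      forall x y, rho x y = 0 -> x = y,
      forall x y, rho x y = rho y x,
      forall y x z, rho x z <= rho x y + rho y z &
      forall (x : M) (U : set M),
        nbhs x U <-> exists2 e : R, 0 < e & [set y | rho x y < e] `<=` U].

(* f^z for z in Z, where fi is the inverse of f; note Negz m = - (m + 1). *)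
Definition iterz {M : Type} (f fi : M -> M) (z : int) : M -> M :=
  match z with
  | Posz m => iter m f
  | Negz m => iter m.+1 fi
  end.

Section Xstar.
Context {R : realType} {X : metricType R}.

Definition diam : R := sup [set mdist xy.1 xy.2 | xy in [set: X * X]].

Lemma mdist_le_diam (cX : compact [set: X]) (x y : X) : mdist x y <= diam.
Proof.
move: cX => /compact_near_coveringP nc.
have : \forall M \near +oo, [set: X] `<=` (fun z => mdist x z < M).
  apply: (nc R +oo (fun M z => mdist x z < M)) => z _.
  exists (ball z 1, [set M | mdist x z + 1 < M]).
    by split; [exact: nbhsx_ballx|exact: nbhs_pinfty_gt (num_real _)].
  move=> [w M] /= []; rewrite ballEmdist /= => zw; apply: le_lt_trans.
  by rewrite (le_trans (metric_triangle x z w))// lerD2l ltW.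
move=> [K [_ hK]].
have [M hM] : exists M : R, forall z, mdist x z < M.
  by exists (K + 1) => z; apply: hK => //=; rewrite ltrDl.
apply: ub_le_sup; last by exists (x, y).
exists (M + M) => _ [[u v] _ <-] /=.
by rewrite (le_trans (metric_triangle u x v))// lerD// ltW// metric_sym.
Qed.

(* X_* = X + {*}, with * encoded as None. The argument is a phantom carried by
   the type: compactness makes diam finite, and thus dstar a metric. *)
Definition Xstar (_ : compact [set: X]) : Type := option X.

Definition dstar (x y : option X) : R :=
  match x, y with
  | Some x, Some y => mdist x y
  | None, None => 0
  | _, _ => diam + 1
  end.

Variable cX : compact [set: X].

HB.instance Definition _ := Choice.copy (Xstar cX) (option X).

Lemma diam_ge0 : 0 <= diam.
Proof.
have [[x _]|X0] := pselect ([set: X] !=set0).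
  by rewrite (le_trans _ (mdist_le_diam cX x x))// mdist_ge0.
rewrite /diam (_ : [set _ | _ in _] = set0) ?sup0//.
by rewrite -subset0 => r [[x y] _ _]; apply: X0; exists x.
Qed.

Let dstarxx (x : Xstar cX) : dstar x x = 0.
Proof. by case: x => //= x; exact: mdistxx. Qed.

Let diam1_neq0 : diam + 1 <> 0.
Proof. by apply/eqP; rewrite gt_eqF// ltr_wpDl// diam_ge0. Qed.

Let dstar_eq0 (x y : Xstar cX) : dstar x y = 0 -> x = y.
Proof.
move: x y => [x|] [y|] //= xy; try by have := diam1_neq0 xy.
by rewrite (mdist_positivity _ _ xy).
Qed.

Let dstar_sym (x y : Xstar cX) : dstar x y = dstar y x.
Proof. by move: x y => [x|] [y|] //=; exact: metric_sym. Qed.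

Let dstar_triangle (y x z : Xstar cX) : dstar x z <= dstar x y + dstar y z.
Proof.
have D0 := diam_ge0; have D1 : 0 <= diam + 1 by rewrite addr_ge0.
move: x y z => [x|] [y|] [z|] //=; rewrite ?addr0 ?add0r ?addr_ge0//.
- exact: metric_triangle.
- by rewrite lerDr mdist_ge0.
- by rewrite (le_trans (mdist_le_diam cX x z))// ler_wpDr// ?lerDl.
- by rewrite lerDl mdist_ge0.
Qed.

HB.instance Definition _ := isMetric.Build R (Xstar cX)
  dstarxx dstar_eq0 dstar_sym dstar_triangle.

End Xstar.

(* X_*^Z with the product topology. *)
Definition XstarZ {R : realType} {X : metricType R} (cX : compact [set: X]) :=
  prod_topology (fun _ : int => Xstar cX).

Record admissible {R : realType} (eps : nat -> R) (n : nat -> nat)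
    (A B : nat -> {fset nat}) : Prop := Admissible {
  adm_incr : {homo n : k l / (k < l)%N};
  adm_disj : forall k, [disjoint A k & B k]%fset;
  adm_cover : forall k i, (i \in (A k `|` B k)%fset) = (i < n k)%N;
  adm_first : forall k, 0%N \in B k;
  adm_last : forall k, (n k).-1 \in B k;
  adm_cardA : forall k, (2 <= #|` A k|)%N;
  adm_cardA_lt : forall k, (#|` A k|)%:R < (n k)%:R * eps k;
  adm_return : forall k i, (i < n k)%N ->
    exists2 a, a \in A k &
      (a + i)%N \in (A k `|` [fset (n k + a')%N | a' in A k])%fset;
  adm_shift : forall k i, (0 < i)%N -> i%:R <= (n k)%:R / 2 + 1 :> R ->
    Num.sqrt ((n k)%:R / 2) - 1 <=
      (#|` ([fset (a + i)%N | a in A k] `&` B k)%fset |)%:R :> R }.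

Section Construction.
Context {R : realType} {X : metricType R} (cX : compact [set: X]).
Variables (T Ti : X -> X) (n : nat -> nat) (A B : nat -> {fset nat}).

(* Indices are shifted by one: pprev k is p_{k-1}, b'prev k is b'_{k-1} and
   Yprev k is Y_{k-1}. *)
Fixpoint pprev (k : nat) : nat :=
  if k is k'.+1 then (n k' * pprev k')%N else 1%N.

Definition b (k : nat) : nat := #|` B k|.

Fixpoint b'prev (k : nat) : nat :=
  if k is k'.+1 then (b'prev k' * (b k' - 2))%N else 1%N.

(* The rank of i in B_k; on B_k this is the strictly increasing bijection onto
   {0, ..., b_k - 1}. *)
Definition tau (k i : nat) : nat := #|` [fset j in B k | (j < i)%N]%fset |.

Definition f_ (k i : nat) : int :=
  if i == 0%N then 0
  else if i == (n k).-1 then - ((b k)%:Z - 3)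
  else (tau k i)%:Z - ((b k)%:Z - 2).

Definition Tstar : Xstar cX -> Xstar cX := omap T.
Definition Tstar_inv : Xstar cX -> Xstar cX := omap Ti.

Definition g_ (k i : nat) : Xstar cX -> Xstar cX :=
  iterz Tstar Tstar_inv ((b'prev k)%:Z * f_ k i).

Definition Q_ (k : nat) : set (XstarZ cX) :=
  [set x | forall i, i \in B k -> x (i * pprev k)%N%:Z = g_ k i (x 0)].

Definition P_ (k : nat) : set (XstarZ cX) :=
  [set x | forall i, i \in A k -> x (i * pprev k)%N%:Z = None].

(* sigma^m; the shift sigma itself is sigmaZ 1. *)
Definition sigmaZ (m : int) (x : XstarZ cX) : XstarZ cX := fun i => x (i + m).

Fixpoint Yprev (k : nat) : set (XstarZ cX) :=
  if k is k'.+1 then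
    Yprev k' `&`
    \bigcap_(m in [set: int]) (sigmaZ (m * (pprev k'.+1)%:Z) @` (P_ k' `&` Q_ k'))
  else setT.

Definition Ysys : set (XstarZ cX) :=
  \bigcap_(k in [set: nat])
    \bigcup_(r in [set r : nat | (r < pprev k.+1)%N])
      (sigmaZ (- r%:Z) @` Yprev k.+1).

End Construction.

Arguments sigmaZ {R X} cX m x.
Arguments Ysys {R X} cX T Ti n A B.

(* Main.v *)
(* For y in X let xpoint y be * on the negative integers and, at
   t = sum_l d_l p_(l-1) >= 0 with 0 <= d_l < n_l, either * if some d_l lies in
   A_l, or the image of y under all the maps g_l(d_l). This point is in Y, and
   as the f_l are onto intervals, its coordinates at times 0 <= t < p_K include
   all T^(-e) y with 0 <= e < b'_K. Hence orbits that are separated in X within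
   time b'_K yield points of Y separated within time p_K, while
   b'_K / p_K >= prod_(l <= K) (1 - 2 eps_l) since b_l - 2 >= n_l - 2 #A_l.
   This only controls s_n(X) along n = b'_K, which suffices: coding an orbit of
   length q m by the points of a maximal (m, eps)-separated set that shadow its
   q pieces gives s_(q m)(X, 2 eps) <= s_m(X, eps)^q. *)
Require Import Defs.
From HB Require Import structures.
From mathcomp Require Import all_boot all_order all_algebra finmap.
From mathcomp Require Import all_classical all_reals all_analysis.
From mathcomp Require Import zify lra.

Set Implicit Arguments.
Unset Strict Implicit.
Unset Printing Implicit Defensive.

Import Order.TTheory GRing.Theory Num.Theory.
Import numFieldNormedType.Exports.

Local Open Scope classical_set_scope.
Local Open Scope ring_scope.

(** * Points of Y *)

Section IterZ.
Context {M : Type} {f fi : M -> M}.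
Hypotheses (fK : cancel f fi) (fiK : cancel fi f).

Lemma iterzS z x : iterz f fi (z + 1) x = f (iterz f fi z x).
Proof.
case: z => [m|[|m]]; first by rewrite addrC.
  by rewrite /= fiK.
by rewrite (_ : Negz m.+1 + 1 = Negz m) /= ?fiK//; lia.
Qed.

Lemma iterzD z w x : iterz f fi (z + w) x = iterz f fi z (iterz f fi w x).
Proof.
elim/int_rect: z => [|m IH|m IH]; first by rewrite add0r.
  by rewrite (_ : m.+1%:Z + w = m%:Z + w + 1) ?iterzS ?IH//; lia.
rewrite -[LHS]fK -iterzS (_ : - m.+1%:Z + w + 1 = - m%:Z + w); last lia.
by rewrite IH -[in LHS](_ : - m.+1%:Z + 1 = - m%:Z) ?iterzS ?fK//; lia.
Qed.

Lemma iterzC z w x :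
  iterz f fi z (iterz f fi w x) = iterz f fi w (iterz f fi z x).
Proof. by rewrite -!iterzD addrC. Qed.

End IterZ.

(** * Cardinalities of the digit sets, ranks in B_k, and mixed-radix digits *)

Section Digits.
Context {R : realType} {eps : nat -> R} {n : nat -> nat}
  {A B : nat -> {fset nat}}.
Hypotheses (eps_bound : forall k, 0 < eps k < 1 / 2)
  (nAB : admissible eps n A B).

Lemma card_AB k : (#|` A k| + #|` B k|)%N = n k.
Proof.
have -> : n k = #|` A k `|` B k|%fset.
  rewrite -[LHS](size_iota 0) -(undup_id (iota_uniq 0 (n k))).
  rewrite -(size_seq_fset tt).
  congr (size (enum_fset _)); apply/fsetP => i.
  by rewrite (adm_cover nAB) seq_fsetE mem_iota.
have /eqP AB0 : [disjoint A k & B k]%fset by exact: adm_disj nAB k.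
by rewrite -cardfsUI AB0 cardfs0 addn0.
Qed.

Lemma n_gt1 k : (1 < n k)%N.
Proof. by rewrite -(card_AB k) (leq_trans (adm_cardA nAB k)) ?leq_addr. Qed.

Lemma lt_n k i : i \in B k -> (i < n k)%N.
Proof. by move=> iB; rewrite -(adm_cover nAB) in_fsetU iB orbT. Qed.

Lemma notin_A k i : i \in B k -> i \notin A k.
Proof.
move=> iB; apply/negP => iA.
by move: (adm_disj nAB k) => /fdisjointP/(_ i iA); rewrite iB.
Qed.

Lemma card_AA k : (#|` A k| + #|` A k| < n k)%N.
Proof.
rewrite -(ltr_nat R) natrD; have := adm_cardA_lt nAB k.
have /andP[e0 e1] := eps_bound k.
have n0 : 0 < (n k)%:R :> R by rewrite ltr0n (ltn_trans _ (n_gt1 k)).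
have : (n k)%:R * eps k < (n k)%:R * (1 / 2) by rewrite ltr_pM2l.
lra.
Qed.

(** As eps_k < 1/2, the set A_k fills less than half of the n_k digits, so b_k > #A_k >= 2. The
    truncated difference b_k - 2 is therefore a true one, and positive. *)
Lemma b_gt2 k : (2 < b B k)%N.
Proof.
have := card_AA k; have := card_AB k; have := adm_cardA nAB k.
by rewrite /b; lia.
Qed.

Lemma b'prev_gt0 k : (0 < b'prev B k)%N.
Proof. by elim: k => //= k IH; rewrite muln_gt0 IH subn_gt0 b_gt2. Qed.

Lemma pprev_gt0 k : (0 < pprev n k)%N.
Proof. by elim: k => //= k IH; rewrite muln_gt0 IH andbT ltnW// n_gt1. Qed.

Lemma ltn_pprev k : (k < pprev n k)%N.
Proof. by elim: k => //= k IH; have := n_gt1 k; nia. Qed.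

Lemma dvdn_pprev k l : (k <= l)%N -> (pprev n k %| pprev n l)%N.
Proof.
elim: l => [|l IH]; first by rewrite leqn0 => /eqP ->.
by rewrite leq_eqVlt ltnS => /predU1P[->//|/IH kl /=]; rewrite dvdn_mull.
Qed.

Lemma prod_le_ratio k :
  \prod_(i < k) (1 - 2 * eps i) <= (b'prev B k)%:R / (pprev n k)%:R :> R.
Proof.
have p0 l : 0 < (pprev n l)%:R :> R by rewrite ltr0n pprev_gt0.
elim: k => [|k IH]; first by rewrite big_ord0 divr1.
rewrite big_ord_recr /= !natrM [(n k)%:R * _]mulrC invfM.
rewrite mulrACA ler_pM// ?prodr_ge0//.
- by move=> i _; have /andP[] := eps_bound i; lra.
- by have /andP[] := eps_bound k; lra.
rewrite ler_pdivlMr ?ltr0n ?(ltn_trans _ (n_gt1 k))//.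
rewrite natrB; last exact/ltnW/b_gt2.
have := adm_cardA_lt nAB k; have := adm_cardA nAB k.
rewrite -(ler_nat R) -(card_AB k) natrD /b; lra.
Qed.

Lemma tauS k i : tau B k i.+1 = (tau B k i + (i \in B k))%N.
Proof.
rewrite /tau; have [iB|iB] := boolP (i \in B k).
  rewrite addn1 -[RHS]/(1 + _)%N.
  have -> : [fset j in B k | (j < i.+1)%N]%fset
          = (i |` [fset j in B k | (j < i)%N])%fset.
    apply/fsetP => j; rewrite !inE /= ltnS leq_eqVlt.
    by have [->|] := eqVneq j i; rewrite ?iB ?andbT.
  by rewrite cardfsU1 !inE /= ltnn andbF.
rewrite addn0; congr (#|` _|); apply/fsetP => j; rewrite !inE /= ltnS leq_eqVlt.
by have [->|] := eqVneq j i; rewrite ?(negbTE iB).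
Qed.

Lemma tau0 k : tau B k 0 = 0%N.
Proof.
apply/eqP; rewrite cardfs_eq0 -fsubset0; apply/fsubsetP => j.
by rewrite !inE andbF.
Qed.

Lemma tau_n k : tau B k (n k) = b B k.
Proof.
congr (#|` _|); apply/fsetP => j; rewrite !inE /=.
by have [/lt_n ->|] := boolP (j \in B k).
Qed.

(** Discrete intermediate values: [tau] climbs from 0 to b_k on [0, n_k] and rises, by one, exactly
    after each element of B_k. *)
Lemma tau_surj k t : (t < b B k)%N -> exists2 i, i \in B k & tau B k i = t.
Proof.
rewrite -tau_n; elim: (n k) => [|N IH]; first by rewrite tau0.
rewrite tauS; have [/IH//|] := ltnP t (tau B k N).
case: (boolP (N \in B k)) => NB.
  by exists N => //; lia.
by lia.
Qed.

(** The endpoints 0 and n_k - 1 only repeat the extreme values of f_k. The witness has rank b_k - 2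
    - e, which lies between 1 and b_k - 2, whereas the endpoints have ranks 0 and b_k - 1. *)
Lemma f_surj k e : (e < b B k - 2)%N ->
  exists2 i, i \in B k & f_ n B k i = - e%:Z.
Proof.
move=> eb; have [] := @tau_surj k (b B k - 2 - e); first lia.
move=> i iB ti; exists i => //; rewrite /f_.
case: eqP => [i0|_]; first by move: ti; rewrite i0 tau0; lia.
case: eqP => [il|_]; last by lia.
have := tauS k i; rewrite il prednK ?tau_n ?(ltn_trans _ (n_gt1 k))//.
by rewrite (adm_last nAB) -il ti; lia.
Qed.

(** The coefficient of p_(k-1) in the expansion of t in the mixed radix n_0, n_1, ... *)
Definition dig k t : nat := ((t %/ pprev n k) %% n k)%N.

Lemma dig_small k t : (t < pprev n k)%N -> dig k t = 0%N.
Proof. by move=> tk; rewrite /dig divn_small ?mod0n. Qed.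

Lemma dig_top k j t : (j < n k)%N -> (t < pprev n k)%N ->
  dig k (j * pprev n k + t) = j.
Proof.
move=> jk tk.
by rewrite /dig divnMDl ?pprev_gt0// divn_small// addn0 modn_small.
Qed.

Lemma dig_low l k j t : (l < k)%N -> dig l (j * pprev n k + t) = dig l t.
Proof.
move=> lk; have /dvdnP[q ->] := @dvdn_pprev l.+1 k lk.
by rewrite /dig /= !mulnA divnMDl ?pprev_gt0// modnMDl.
Qed.

(** No carry occurs: j p_(k-1) < p_k, so the sum stays in the block of length p_k that starts at m
    p_k. *)
Lemma dig_high l k m j : (k < l)%N -> (j < n k)%N ->
  dig l (m * pprev n k.+1 + j * pprev n k) = dig l (m * pprev n k.+1).
Proof.
move=> kl jk; rewrite /dig; congr (_ %% _)%N.
have /dvdnP[q ->] := @dvdn_pprev k.+1 l kl.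
have jp : (j * pprev n k < pprev n k.+1)%N by rewrite /= ltn_pmul2r ?pprev_gt0.
rewrite [(q * _)%N]mulnC divnMA [in RHS]divnMA; congr (_ %/ _)%N.
by rewrite divnMDl ?pprev_gt0// mulnK ?pprev_gt0// divn_small ?addn0.
Qed.

(** * The points of Y attached to points of X *)

Context {X : metricType R} (cX : compact [set: X]) {T Ti : X -> X}.
Hypotheses (TK : cancel T Ti) (TiK : cancel Ti T).

Let TsK : cancel (@Tstar R X cX T) (@Tstar_inv R X cX Ti).
Proof. by case=> //= x; rewrite TK. Qed.

Let TisK : cancel (@Tstar_inv R X cX Ti) (@Tstar R X cX T).
Proof. by case=> //= x; rewrite TiK. Qed.

Let gk := @g_ R X cX T Ti n B.

Lemma iterz_None z :
  iterz (@Tstar R X cX T) (@Tstar_inv R X cX Ti) z None = None.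
Proof.
have it (h : X -> X) m : iter m (omap h) None = None by elim: m => //= m ->.
by case: z => m; rewrite /iterz it.
Qed.

Lemma iterz_Some z x :
  iterz (@Tstar R X cX T) (@Tstar_inv R X cX Ti) z (Some x) =
  Some (iterz T Ti z x).
Proof.
have it (h : X -> X) m : iter m (omap h) (Some x) = Some (iter m h x).
  by elim: m => //= m ->.
by case: z => m; rewrite /iterz it.
Qed.

Lemma g_0 k x : gk k 0%N x = x.
Proof. by rewrite /gk /g_ /f_ eqxx mulr0. Qed.

(* L only bounds the number of digits read: the digits beyond those of t are 0
   and g_k(0, _) is the identity (xval_stable). *)
Fixpoint xval (L t : nat) (y : X) : Xstar cX :=
  if L is L'.+1 then
    if dig L' t \in A L' then None else gk L' (dig L' t) (xval L' t y)
  else Some y.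

Lemma dig0_step L t y : dig L t = 0%N -> xval L.+1 t y = xval L t y.
Proof.
by move=> d0; rewrite /= d0 (negbTE (notin_A _)) ?(adm_first nAB)// g_0.
Qed.

Lemma xval_stable L K t y : (K <= L)%N -> (t < pprev n K)%N ->
  xval L t y = xval K t y.
Proof.
move=> /subnK <- tK; elim: (L - K)%N => // d IH.
rewrite addSn dig0_step// dig_small//.
by rewrite (leq_trans tK)// dvdn_leq ?pprev_gt0// dvdn_pprev// leq_addl.
Qed.

(** The exponents b'_(l-1) f_l(d_l) add up like an expansion in the mixed radix b_l - 2. Induction
    on the quotient and remainder of e by [b'prev B K]: the remainder gives the low digits of t, and
    [f_surj] turns the quotient into its top digit. *)
Lemma xval_cover K e : (e < b'prev B K)%N -> exists2 t, (t < pprev n K)%N &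
  forall y, xval K t y = Some (iterz T Ti (- e%:Z) y).
Proof.
elim: K e => [|K IH] e /=; first by rewrite ltnS leqn0 => /eqP ->; exists 0%N.
move=> eK; have [t tK tE] := IH _ (ltn_pmod e (b'prev_gt0 K)).
have [|i iB fi] := @f_surj K (e %/ b'prev B K).
  by rewrite ltn_divLR ?b'prev_gt0// mulnC.
exists (i * pprev n K + t)%N => [|y].
  apply: (@leq_trans (i.+1 * pprev n K)).
    by rewrite mulSn addnC ltn_add2r.
  by rewrite leq_pmul2r ?pprev_gt0// lt_n.
rewrite dig_top ?lt_n// (negbTE (notin_A iB)).
have low L : (L <= K)%N -> xval L (i * pprev n K + t) y = xval L t y.
  by elim: L => //= L IHL LK; rewrite dig_low// IHL// ltnW.
rewrite low// tE /gk /g_ fi iterz_Some -iterzD//; congr (Some (iterz _ _ _ _)).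
by have := divn_eq e (b'prev B K); lia.
Qed.

(** This is the level-k constraint P_k, Q_k at the block starting at m p_k. That time has digits 0
    up to level k, so adding j p_(k-1) changes digit k only. The new map g_k(j) acts before those of
    higher levels, but all are powers of T_*, so they commute and fix *. *)
Lemma xval_level L k m j y : (k < L)%N -> (j < n k)%N ->
  xval L (m * pprev n k.+1 + j * pprev n k) y =
  if j \in A k then None else gk k j (xval L (m * pprev n k.+1) y).
Proof.
move=> kL jk.
have low u i l : (l <= k)%N ->
    xval l (u * pprev n k.+1 + i * pprev n k) y = Some y.
  elim: l => // l IHl lk; rewrite dig0_step ?IHl ?(ltnW lk)//.
  rewrite dig_low ?(ltn_trans lk)// -[(i * _)%N]addn0 dig_low//.
  by rewrite dig_small// pprev_gt0.
have digk u i : (i < n k)%N -> dig k (u * pprev n k.+1 + i * pprev n k) = i.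
  by move=> ik; rewrite dig_low// -[(i * _)%N]addn0 dig_top// pprev_gt0.
have nk0 : (0 < n k)%N by exact: leq_ltn_trans jk.
move: kL => /subnK <-; elim: (L - k.+1)%N => [|d IH].
  have := digk m _ nk0; have := low m 0%N k (leqnn k).
  rewrite mul0n addn0 add0n => lowv digv.
  by rewrite (dig0_step _ digv) lowv [LHS]/= digk// low.
rewrite addSn /= dig_high//; last by rewrite addnS ltnS leq_addl.
rewrite IH; case: ifPn => // _.
  by case: ifP => // _; rewrite /gk /g_ iterz_None.
by case: ifP => // _; rewrite /gk /g_ ?iterz_None// iterzC.
Qed.

(** Reading t levels at time t is enough, because t < [pprev n t]. *)
Definition xpoint (y : X) : XstarZ cX := fun i : int =>
  if i is Posz t then xval t t y else None.

Lemma xpoint_xval L t y : (t < pprev n L)%N -> xpoint y t%:Z = xval L t y.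
Proof.
move=> tL /=; have [LT|LT] := leqP L t; first exact: xval_stable.
by rewrite (@xval_stable L t t)// ?ltn_pprev// ltnW.
Qed.

(** The blocks of all levels are aligned at time 0, so the phase r = 0 serves for every k. *)
Lemma level_Ysys (x : XstarZ cX) :
  (forall k (m : int) j, (j < n k)%N ->
     x (m * (pprev n k.+1)%:Z + (j * pprev n k)%N%:Z) =
     if j \in A k then None else gk k j (x (m * (pprev n k.+1)%:Z))) ->
  Ysys cX T Ti n A B x.
Proof.
move=> lev.
have Yk k : Yprev T Ti n A B k x.
  elim: k => //= k IH; split => // m _.
  exists (fun i => x (i - m * (pprev n k.+1)%:Z)); last first.
    by apply/funext => i; rewrite /sigmaZ addrK.
  split => j jk; rewrite /= ?sub0r addrC -mulNr lev.
  - by rewrite jk.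
  - by rewrite -(adm_cover nAB) in_fsetU jk.
  - by rewrite (negbTE (notin_A jk)).
  - exact: lt_n.
move=> k _; exists 0%N; first exact: pprev_gt0.
by exists x; [exact: Yk|apply/funext => i; rewrite /sigmaZ oppr0 addr0].
Qed.

Lemma xpoint_Ysys y : Ysys cX T Ti n A B (xpoint y).
Proof.
apply: level_Ysys => k [m|m] j jk.
  rewrite -PoszM -PoszD; set u := (m * _ + _)%N; set v := (m * _)%N.
  (* Both times are read with the common number of levels u + k + 1, which also exceeds k. *)
  have uL : (u < pprev n (u + k.+1))%N.
    by rewrite (leq_ltn_trans _ (ltn_pprev _))// leq_addr.
  rewrite (xpoint_xval _ uL) (@xpoint_xval (u + k.+1) v).
    by rewrite xval_level// addnS ltnS leq_addl.
  by rewrite (leq_ltn_trans _ uL)// leq_addr.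
(* For negative m the whole block of length p_k ends before time 0, so only * is seen. *)
have neg (z : int) : z < 0 -> xpoint y z = None by case: z.
have jp : (j * pprev n k < pprev n k.+1)%N by rewrite /= ltn_pmul2r ?pprev_gt0.
rewrite !neg.
- by case: ifP => // _; rewrite /gk /g_ iterz_None.
- by rewrite nmulr_rlt0// ltz_nat pprev_gt0.
- by move: jp; rewrite NegzE; nia.
Qed.

(** A point of Y that exists even when X is empty; it makes the entropy of Y nonnegative. *)
Lemma Ysys_star : Ysys cX T Ti n A B (fun=> None).
Proof.
apply: level_Ysys => k m j jk; case: ifP => // _.
by rewrite /gk /g_ iterz_None.
Qed.

End Digits.

(** * Separated sets *)

Section SepNum.
Context {R : realType} {M : Type} (d : M -> M -> R) (f : M -> M).
Implicit Types (S E : set M).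

Definition sep_size S m eps : set nat :=
  [set r | exists E, [/\ E `<=` S, (E #= `I_r)%card & sep_set d f m eps E]].

Lemma sep_size0 S m eps : sep_size S m eps 0%N.
Proof. by exists set0; split => //; rewrite II0. Qed.

Lemma sep_size1 S m eps x : S x -> sep_size S m eps 1%N.
Proof.
move=> Sx; exists [set x]; split.
- by move=> _ ->.
- exact: card_set1.
- by move=> _ _ -> ->.
Qed.

Lemma sep_size_le S m eps r : sep_size S m eps r ->
  (r%:R%:E <= sep_num d f S m eps)%E.
Proof. by move=> Sr; apply: ereal_sup_ubound; exists r. Qed.

Lemma sep_num_le S m eps a :
  (forall r, sep_size S m eps r -> (r%:R%:E <= a)%E) ->
  (sep_num d f S m eps <= a)%E.
Proof. by move=> ha; apply: ge_ereal_sup => _ [r Sr <-]; exact: ha. Qed.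

Lemma sep_num_ge0 S m eps : (0 <= sep_num d f S m eps)%E.
Proof. exact: (sep_size_le (sep_size0 _ _ _)). Qed.

Lemma lne_sep_num_ge0 S m eps x : S x -> (0 <= lne (sep_num d f S m eps))%E.
Proof.
by move=> Sx; rewrite lne_ge0; exact: (sep_size_le (sep_size1 _ _ Sx)).
Qed.

Lemma lne_homo (a b : \bar R) : (0 <= a)%E -> (a <= b)%E -> (lne a <= lne b)%E.
Proof.
by move=> a0 ab; rewrite lee_lne ?in_itv //= ?a0 ?(le_trans a0)// leey.
Qed.

Lemma sep_num_mono S m eps eps' : eps <= eps' ->
  (sep_num d f S m eps' <= sep_num d f S m eps)%E.
Proof.
move=> ee; apply: sep_num_le => r [E [ES Er sE]]; apply: sep_size_le.
exists E; split => // x y Ex Ey xy; have [j jm dj] := sE x y Ex Ey xy.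
by exists j => //; exact: le_lt_trans dj.
Qed.

Definition growth S eps : \bar R :=
  limn_esup (fun n : nat => ((n%:R^-1)%:E * lne (sep_num d f S n eps))%E).

Lemma limn_esup_ub (u : (\bar R)^nat) a :
  (\forall n \near \oo, (u n <= a)%E) -> (limn_esup u <= a)%E.
Proof.
move=> ua; rewrite /limn_esup limf_esupE.
apply: ge_ereal_inf; exists (ereal_sup (u @` [set n | (u n <= a)%E])).
  by exists [set n | (u n <= a)%E].
by apply: ge_ereal_sup => _ [n un <-].
Qed.

(** Since N <= phi N, every tail of u contains a term that is at least a; [phi] need not be
    monotone. *)
Lemma limn_esup_lb (u : (\bar R)^nat) (phi : nat -> nat) a :
  (forall k, (k <= phi k)%N) -> (forall k, (a <= u (phi k))%E) ->
  (a <= limn_esup u)%E.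
Proof.
move=> phik ua; rewrite /limn_esup limf_esupE; apply: le_ereal_inf_tmp.
move=> _ [V [N _ NV] <-]; apply: (le_trans (ua N)); apply: ereal_sup_ubound.
by exists (phi N) => //; apply: NV => /=.
Qed.

Lemma growth_mono S eps eps' : eps <= eps' -> (growth S eps' <= growth S eps)%E.
Proof.
move=> ee; rewrite /growth !limn_esup_lim; apply: lee_lim => //.
- exact: is_cvg_esups.
- exact: is_cvg_esups.
apply: nearW => N; apply: ge_ereal_sup => _ [k kN <-].
apply: (@le_trans _ _ ((k%:R^-1)%:E * lne (sep_num d f S k eps))%E).
  apply: lee_wpmul2l; first by rewrite lee_fin invr_ge0.
  by apply: lne_homo; [exact: sep_num_ge0|exact: sep_num_mono].
by apply: ereal_sup_ubound; exists k.
Qed.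

(** The growth rate is nonincreasing in eps, so its limit at 0+ exists and is the supremum. *)
Lemma htopE S : htop d f S = ereal_sup (growth S @` `]0, +oo[).
Proof.
apply/cvg_lim => //.
apply: (@nonincreasing_at_right_cvge R (growth S) 0 +oo%O) => // e e' _ _.
exact: growth_mono.
Qed.

Lemma growth_le_htop S eps : 0 < eps -> (growth S eps <= htop d f S)%E.
Proof.
move=> e0; rewrite htopE; apply: ereal_sup_ubound.
by exists eps => //=; rewrite in_itv/= e0.
Qed.

Lemma growth_ge0 S eps x : S x -> (0 <= growth S eps)%E.
Proof.
move=> Sx; apply: (@limn_esup_lb _ id) => // k.
by rewrite mule_ge0 ?lee_fin ?invr_ge0// (lne_sep_num_ge0 _ _ Sx).
Qed.

End SepNum.

(** * Bounding the growth rate by one separation number *)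

Section Coding.
Context {R : realType} {X : metricType R} (T : X -> X).

Lemma sep_size_fset m e (S : set X) r : sep_size (@mdist R X) T S m e r ->
  exists E : {fset X}, [/\ [set` E] `<=` S, #|` E| = r &
                           sep_set (@mdist R X) T m e [set` E]].
Proof.
move=> [E [ES Er sE]]; exists (fset_set E).
have Ef : finite_set E by apply/finite_setP; exists r.
by rewrite fset_setK//; split => //; exact: card_fset_set.
Qed.

(* Two orbits shadowed on each block [a m, (a + 1) m) by the same point of a
   maximal separated set stay 2e-close. *)
Lemma sep_size_coding m q k e N r : 0 <= e -> (0 < m)%N -> (k <= q * m)%N ->
  sep_size (@mdist R X) T setT m e N ->
  ~ sep_size (@mdist R X) T setT m e N.+1 ->
  sep_size (@mdist R X) T setT k (2 * e) r -> (r <= N ^ q)%N.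
Proof.
move=> e0 m0 kq /sep_size_fset[E [_ EN sE]] SN /sep_size_fset[F [_ <- sF]].
(* Maximality of E: a point shadowed by no element of E could be added to it, giving N + 1 separated
   points. *)
have near_E x : exists c : E, forall j, (j < m)%N ->
    mdist (iter j T x) (iter j T (val c)) <= e.
  apply: contrapT => nE; apply: SN.
  have far c : c \in E ->
      exists2 j, (j < m)%N & e < mdist (iter j T x) (iter j T c).
    move=> cE; apply: contrapT => nj; apply: nE; exists [` cE]%fset => j jm /=.
    by rewrite leNgt; apply/negP => ej; apply: nj; exists j.
  have xE : x \notin E by apply/negP => /far[j _]; rewrite mdistxx ltNge e0.
  exists [set` (x |` E)%fset]; split => //.
    by apply/card_eq_fsetP; rewrite cardfsU1 xE EN.
  move=> u v /=; rewrite !in_fset1U => /predU1P[->|uE] /predU1P[->|vE] uv //.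
  - exact: far.
  - by have [j jm ej] := far _ uE; exists j => //; rewrite metric_sym.
  - exact: sE.
have [c cP] := choice near_E.
pose code (x : F) := [ffun a : 'I_q => c (iter (a * m) T (val x))].
suff code_inj : injective code.
  rewrite -EN !cardfE -[q in leqRHS]card_ord -card_ffun.
  exact: leq_card code_inj.
move=> x y xy; apply/val_inj; apply: contrapT => nxy.
have [j jk] := sF _ _ (valP x) (valP y) nxy; apply/negP; rewrite -leNgt.
have jq : (j %/ m < q)%N by rewrite ltn_divLR// (leq_trans jk).
have := congr1 (fun g : {ffun 'I_q -> E} => g (Ordinal jq)) xy.
rewrite !ffunE /= => cxy.
have jE z : iter j T z = iter (j %% m) T (iter (j %/ m * m) T z).
  by rewrite -iterD addnC -divn_eq.
rewrite !jE mulr2n mulrDl mul1r.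
set z := c _ in cxy.
apply: le_trans (metric_triangle _ (iter (j %% m) T (val z)) _) _.
apply: lerD; first by apply: cP; rewrite ltn_pmod.
by rewrite cxy metric_sym; apply: cP; rewrite ltn_pmod.
Qed.

(** Coding with q = k / m + 1 blocks bounds the count at time k by N ^ q, where N is the maximal
    size at time m. The rate is then at most log N / m + log N / k, and the last term vanishes. *)
Lemma growth_le m e (x : X) : 0 <= e -> (0 < m)%N ->
  (growth (@mdist R X) T setT (2 * e) <=
   (m%:R^-1)%:E * lne (sep_num (@mdist R X) T setT m e))%E.
Proof.
move=> e0 m0.
(* Either every size is attained and the right side is +oo, or some N is attained while N + 1 is
   not. *)
have [all|/existsNP[N /not_implyP[SN nSN]]] :=
    pselect (forall N, sep_size (@mdist R X) T setT m e N ->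
                       sep_size (@mdist R X) T setT m e N.+1).
  have -> : sep_num (@mdist R X) T setT m e = +oo%E.
    apply/eqyP => a a0.
    apply: le_trans (sep_size_le (r := (Num.truncn a).+1) _).
      by rewrite lee_fin ltW// truncnS_gt.
    by elim: (_.+1) => [|r]; [exact: sep_size0|exact: all].
  by rewrite /= mulry gtr0_sg ?invr_gt0 ?ltr0n// mul1e leey.
have N0 : (0 < N)%N.
  rewrite lt0n; apply/eqP => N0; apply: nSN; rewrite N0.
  exact: (@sep_size1 _ _ _ _ _ _ _ x).
pose L : R := ln N%:R.
have L0 : 0 <= L by rewrite ln_ge0// ler1n.
apply: (@le_trans _ _ (m%:R^-1 * L)%:E); last first.
  rewrite EFinM; apply: lee_wpmul2l; first by rewrite lee_fin invr_ge0.
  rewrite -lne_EFin ?ltr0n//; apply: lne_homo; rewrite ?lee_fin//.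
  exact: sep_size_le.
apply/lee_addgt0Pr => dl dl0; apply: limn_esup_ub; near=> k.
have k0 : 0 < k%:R :> R.
  by rewrite ltr0n; near: k; exists 1%N.
apply: (@le_trans _ _ (k%:R^-1 * ((k %/ m).+1%:R * L))%:E).
  rewrite EFinM; apply: lee_wpmul2l; first by rewrite lee_fin invr_ge0.
  rewrite [_ * L]mulr_natl /L -lnXn ?ltr0n// -lne_EFin ?exprn_gt0 ?ltr0n//.
  apply: lne_homo.
    exact: sep_num_ge0.
  apply: sep_num_le => r Sr; rewrite lee_fin -natrX ler_nat.
  by apply: (sep_size_coding e0 m0 _ SN nSN Sr); rewrite ltnW// ltn_ceil.
rewrite -EFinD lee_fin mulrA.
have km : (k %/ m).+1%:R <= k%:R / m%:R + 1 :> R.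
  by rewrite -natr1 lerD2r ler_pdivlMr ?ltr0n// -natrM ler_nat leq_trunc_div.
apply: (@le_trans _ _ (k%:R^-1 * (k%:R / m%:R + 1) * L)).
  by rewrite ler_wpM2r// ler_wpM2l// invr_ge0 ltW.
rewrite mulrDr mulr1 mulrA mulVf ?gt_eqF// mul1r mulrDl lerD2l.
rewrite mulrC ler_pdivrMr// -ler_pdivrMl//.
by near: k; exact: nbhs_infty_ger.
Unshelve. all: by end_near. Qed.

End Coding.

(** * Comparison of the two systems *)

Section Coordinate.
Context {R : realType} {X : metricType R} (cX : compact [set: X]).

Lemma compact_Xstar : compact [set: Xstar cX].
Proof.
have cS : continuous (Some : X -> Xstar cX).
  (* [Some] preserves distances, so its continuity is that of the identity of X. *)
  move=> x; apply/metricType_numDomainType.cvgrPdist_lt => e e0.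
  exact: (metricType_numDomainType.cvgrPdist_lt _ _).1
    (@cvg_id _ (nbhs x)) e e0.
rewrite (_ : setT = (Some @` [set: X] : set (Xstar cX)) `|`
                    [set (None : Xstar cX)]).
  apply: compactU; last exact: compact_set1.
  by apply: continuous_compact => //; exact: continuous_subspaceT.
by apply/seteqP; split => // -[x|] _; [left; exists x|right].
Qed.

(** Uniform continuity of a coordinate. As [rho] is an arbitrary metric of the product topology, the
    modulus comes from compactness of the product (Tychonoff). *)
Lemma coord_unif (rho : XstarZ cX -> XstarZ cX -> R) (i : int) e :
  compatible_metric rho -> 0 < e ->
  exists2 dl, 0 < dl & forall x y, rho x y <= dl -> mdist (x i) (y i) <= e.
Proof.
move=> [_ _ rhoC rhoD rhoN] e0.
have cY : compact [set: XstarZ cX].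
  have := @tychonoff int (fun=> Xstar cX) (fun=> setT) (fun=> compact_Xstar).
  by congr compact; apply/seteqP.
have near0 (x : XstarZ cX) : exists2 r, 0 < r &
    forall z, rho x z < r -> mdist (x i) (z i) < e / 2.
  have /rhoN[r r0 rP] : nbhs x [set z : XstarZ cX | mdist (x i) (z i) < e / 2].
    have e20 : 0 < e / 2 by rewrite divr_gt0.
    have /metricType_numDomainType.cvgrPdist_lt pi :=
      @proj_continuous _ (fun _ : int => Xstar cX) i x.
    exact: (pi (nbhs_filter x) _ e20).
  by exists r.
pose P (dl : R) (x : XstarZ cX) :=
  forall y, rho x y <= dl -> mdist (x i) (y i) <= e.
have /(_ _ 0^'+ P _)[|r /= r0 rP] := (compact_near_coveringP _).1 cY.
  move=> x _; have [r r0 rP] := near0 x.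
  have r20 : 0 < r / 2 by rewrite divr_gt0.
  (* Halving r keeps both u and any y with rho u y <= dl inside the r-ball around x. *)
  exists ([set z | rho x z < r / 2], [set t | t < r / 2]).
    split; last exact: nbhs_right_lt.
    by apply/rhoN; exists (r / 2).
  move=> [u dl] [/= xu dlr] y uy.
  apply: le_trans (metric_triangle _ (x i) _) _.
  rewrite [leRHS]splitr ltW// ltrD//.
    by rewrite metric_sym rP// (lt_trans xu)// ltr_pdivrMr// ltr_pMr// ltr1n.
  apply: rP; apply: le_lt_trans (rhoD u _ _) _; rewrite [ltRHS]splitr ltrD//.
  exact: le_lt_trans dlr.
have r20 : 0 < r / 2 by rewrite divr_gt0.
exists (r / 2) => // x y; apply: rP => //=.
by rewrite sub0r normrN gtr0_norm// ltr_pdivrMr// ltr_pMr// ltr1n.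
Qed.
End Coordinate.

Lemma sep_num_le_Ysys (R : realType) (X : metricType R) (cX : compact [set: X])
  (T Ti : X -> X) (eps : nat -> R) (n : nat -> nat) (A B : nat -> {fset nat})
  (rho : XstarZ cX -> XstarZ cX -> R) (e dl : R) (K : nat) :
  cancel T Ti -> cancel Ti T -> (forall k, 0 < eps k < 1 / 2) ->
  admissible eps n A B -> 0 <= e ->
  (forall x y, rho x y <= dl -> mdist (x 0) (y 0) <= e) ->
  (sep_num (@mdist R X) T setT (b'prev B K) e <=
   sep_num rho (sigmaZ cX 1) (Ysys cX T Ti n A B) (pprev n K) dl)%E.
Proof.
move=> TK TiK eps_bound nAB e0 unif; apply: sep_num_le => r [E [_ Er sE]].
apply: sep_size_le; pose N := (b'prev B K).-1.
(* The coordinates of [xpoint] are backward iterates. Starting from T^N w, with N the largest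
   exponent available, makes the coordinate with exponent N - j equal to T^j w. *)
pose pt w : XstarZ cX := @xpoint R n A B X cX T Ti (iter N T w).
have iter_sigma j (x : XstarZ cX) : iter j (sigmaZ cX 1) x 0 = x j%:Z.
  suff it i : iter j (sigmaZ cX 1) x i = x (i + j%:Z) by rewrite it add0r.
  elim: j i => [|j IH] i; first by rewrite addr0.
  by rewrite iterS /sigmaZ IH; congr (x _); lia.
have iter_cancel j : cancel (iter j T) (iter j Ti).
  by elim: j => // j IH v; rewrite iterSr [iter _ T _]iterS TK IH.
have sep w w' : E w -> E w' -> w <> w' -> exists2 t, (t < pprev n K)%N &
    dl < rho (iter t (sigmaZ cX 1) (pt w)) (iter t (sigmaZ cX 1) (pt w')).
  move=> Ew Ew' ww'; have [j jK ej] := sE _ _ Ew Ew' ww'.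
  have bK := b'prev_gt0 eps_bound nAB K.
  have [|t tK tE] :=
      xval_cover eps_bound nAB cX TK TiK (K := K) (e := (N - j)%N).
    by rewrite /N; lia.
  exists t => //; rewrite ltNge; apply/negP => /unif.
  rewrite !iter_sigma /pt !(xpoint_xval nAB _ _ tK) !tE.
  have back v : iterz T Ti (- (N - j)%N%:Z) (iter N T v) = iter j T v.
    rewrite -/(iterz T Ti N%:Z v) -iterzD// -/(iterz T Ti j%:Z v).
    by congr iterz; rewrite /N; lia.
  by rewrite !back leNgt ej.
exists (pt @` E); split.
- by move=> _ [w _ <-]; exact: (@xpoint_Ysys _ _ _ _ _ nAB _ cX _ _ TK TiK).
- apply: card_eq_trans Er; apply: inj_card_eq => w w' _ _ ww'.
  (* Coordinate 0 of [pt w] is T^N w, which determines w. *)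
  have [/(congr1 (iter N Ti))] := congr1 (fun x : XstarZ cX => x 0) ww'.
  by rewrite !iter_cancel.
move=> _ _ [w Ew <-] [w' Ew' <-] ww'; apply: sep => // ww.
by apply: ww'; rewrite ww.
Qed.

Theorem proposition3p7 (R : realType) (X : metricType R)
  (cX : compact [set: X])
  (T Ti : X -> X) (TK : cancel T Ti) (TiK : cancel Ti T)
  (cT : continuous T) (cTi : continuous Ti)
  (eps : nat -> R)
  (eps_decr : {homo eps : k l / (k <= l)%N >-> l <= k})
  (eps_bound : forall k, 0 < eps k < 1 / 2)
  (n : nat -> nat) (A B : nat -> {fset nat})
  (nAB : admissible eps n A B)
  (rho : XstarZ cX -> XstarZ cX -> R) (rhoP : compatible_metric rho) :
  (htop (@mdist R X) T [set: X]
     * (limn (fun N => \prod_(k < N) (1 - 2 * eps k)))%:E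
   <= htop rho (sigmaZ cX 1) (Ysys cX T Ti n A B))%E.
Proof.
set H := htop rho _ _; set prods := fun N => _; set c := limn _.
(* All factors lie between 0 and 1, so the partial products decrease to c and each of them is at
   least c. *)
have prods_ge0 N : 0 <= prods N.
  by apply: prodr_ge0 => i _; have /andP[] := eps_bound i; lra.
have prods_decr : nonincreasing_seq prods.
  apply/nonincreasing_seqP => N; rewrite /prods big_ord_recr /=.
  by apply: ler_piMr; [exact: prods_ge0|have /andP[] := eps_bound N; lra].
have cvg_prods : cvgn prods.
  by apply: nonincreasing_is_cvgn => //; exists 0 => _ [N _ <-].
have c0 : 0 <= c by apply: limr_ge => //; exact: nearW.
have c_le N : c <= prods N by exact: nonincreasing_cvgn_ge.
have H0 : (0 <= H)%E.
  apply: le_trans (growth_le_htop _ _ _ (@ltr01 R)).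
  apply: (@growth_ge0 _ _ _ _ _ _ (fun=> None)).
  exact: (@Ysys_star _ _ _ _ _ nAB _ cX).
(* For X empty, htop X is -oo, and -oo * c is 0 when c = 0. *)
have [X0|/set0P[x _]] := eqVneq [set: X] set0.
  apply: le_trans H0; apply: mule_le0_ge0; last by rewrite lee_fin.
  rewrite htopE; apply: ge_ereal_sup => _ [e _ <-].
  apply: limn_esup_ub; apply: nearW => m; rewrite X0.
  apply: mule_ge0_le0; first by rewrite lee_fin invr_ge0.
  rewrite lne_le0; apply: sep_num_le => r [E [E0 Er _]].
  have Eset0 : E = set0 by apply/seteqP; split => // y /E0.
  by rewrite -(card_fset_set Er) Eset0 fset_set0 cardfs0 lee01.
have scale e : 0 < e -> (growth (@mdist R X) T setT (2 * e) * c%:E <= H)%E.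
  move=> e0; have [dl dl0 unif] := coord_unif 0 rhoP e0.
  apply: le_trans (growth_le_htop _ _ _ dl0).
  (* The growth in Y is read only along the times [pprev n k], matched with the times [b'prev B k]
     in X. *)
  apply: (@limn_esup_lb _ _ (pprev n)) => [k|k].
    exact: ltnW (ltn_pprev nAB k).
  have p0 : 0 < (pprev n k)%:R :> R by rewrite ltr0n (pprev_gt0 nAB).
  have b0 : 0 < (b'prev B k)%:R :> R.
    by rewrite ltr0n (b'prev_gt0 eps_bound nAB).
  have g0 : (0 <= lne (sep_num (@mdist R X) T setT (b'prev B k) e))%E.
    exact: (lne_sep_num_ge0 _ _ _ _ (x := x)).
  (* The ratio that dominates c cancels the normalization by [b'prev B k] and leaves the one by
     [pprev n k]. *)
  apply: (@le_trans _ _ (((b'prev B k)%:R^-1)%:E *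
      lne (sep_num (@mdist R X) T setT (b'prev B k) e) *
      ((b'prev B k)%:R / (pprev n k)%:R)%:E)%E).
    apply: lee_pmul; rewrite ?lee_fin//.
    - exact: (growth_ge0 _ _ _ (x := x)).
    - by apply: growth_le => //; [exact: ltW|rewrite -(ltr0n R)].
    - by apply: le_trans (c_le k) _; exact: (prod_le_ratio eps_bound nAB).
  rewrite muleAC -EFinM mulrA mulVf ?gt_eqF// mul1r.
  apply: lee_wpmul2l; first by rewrite lee_fin invr_ge0 ltW.
  apply: lne_homo; first exact: sep_num_ge0.
  exact: (sep_num_le_Ysys _ TK TiK eps_bound nAB (ltW e0) unif).
(* If c = 0 the left side is 0, even for infinite entropy. A positive c can be moved to the other
   side before taking the supremum over scales. *)
move: c0; rewrite le_eqVlt => /predU1P[<-|c0]; first by rewrite mule0.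
rewrite -lee_pdivlMr// htopE; apply: ge_ereal_sup => _ [e + <-].
rewrite /= in_itv/= andbT => e0; rewrite lee_pdivlMr//.
(* Halving e absorbs the doubling of scale due to coding. *)
have := scale (e / 2); rewrite divr_gt0// => /(_ isT).
by rewrite mulrC divfK.
Qed.
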